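(* Let $n>0$ be an integer and $a\in\{0,1\}$. Then \[ \sum_{0\le 3j\le n-a}\frac{(-1)^j(q^3;q^3)_{n-j-1}(1-q^{2n+a})\,q^{3j^2}}{(q;q)_{n-3j-a}\,(q^6;q^6)_{j}} \;=\; \sum_{j=-\infty}^{\infty}(-1)^j q^{3j^2}{2n+a\brack n-3j-a}_q . \]
   Context: For a non-negative integer $L$, $(a;q)_L=\prod_{k=0}^{L-1}(1-aq^k)$. For integers $m,n$, the $q$-binomial coefficient is ${m+n\brack n}_q=\frac{(q;q)_{m+n}}{(q;q)_m(q;q)_n}$ if $m,n\ge 0$ and $0$ otherwise (so ${A\brack B}_q=0$ unless $0\le B\le A$). *)

(* Defs.v *)
From HB Require Import structures.
From mathcomp Require Import all_boot all_order all_algebra.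
From mathcomp Require Import zify.
From mathcomp Require Import boolp classical_sets functions cardinality fsbigop.
Set Implicit Arguments.
Unset Strict Implicit.
Unset Printing Implicit Defensive.
Import Order.TTheory GRing.Theory Num.Theory.
Local Open Scope ring_scope.

Definition qpoch (F : fieldType) (a q : F) (L : nat) : F :=
  \prod_(k < L) (1 - a * q ^+ k).

(* The Gaussian coefficient [A choose B]_q with A = m + n, B = n for integers
   m, n of any sign. *)
Definition qbinom (F : fieldType) (q : F) (A B : int) : F :=
  if (0 <= A - B) && (0 <= B)
  then qpoch q q `|A|%N / (qpoch q q `|A - B|%N * qpoch q q `|B|%N)
  else 0.

(* The sum [\sum_(j \in [set: int])] of fsbigop is 0 by convention when the
   summand has infinite support; this lemma shows that this case does not occur
   for sums over j of multiples of [qbinom q A (B - 3 * j - C)]. *)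
Lemma finite_support_qbinom (F : fieldType) (q : F) (c : int -> F)
    (A B C : int) :
  finite_set [set j : int | c j * qbinom q A (B - 3 * j - C) != 0].
Proof.
pose N := (`|A| + `|B| + `|C|)%N.
pose s : seq int := [seq (i%:Z - N%:Z) | i <- iota 0 (2 * N).+1].
apply: (@sub_finite_set _ _ [set` s]); last exact: finite_seq.
move=> /= j; rewrite /qbinom; case: ifPn => [/andP[h1 h2] _|_]; last first.
  by rewrite mulr0 eqxx.
have -> : j = (absz (j + N%:Z))%:Z - N%:Z :> int by rewrite /N; lia.
apply: (map_f (fun i : nat => i%:Z - N%:Z)); rewrite mem_iota /N; lia.
Qed.

(* Main.v *)
(* With p = q^3, the factor (-1)^r / (p^2;p^2)_r on the left-hand side equals
   sum_j (-1)^j p^(a (r - j)) / ((p;p)_(r - j) (p;p)_(r + j + a)), a form of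
   Gauss's evaluation of alternating sums of Gaussian coefficients. After
   exchanging the two sums, the sum over r for fixed j is a terminating
   q-Pfaff-Saalschuetz sum in base p with numerator parameters
   q^(a-n+3j), q^(a+1-n+3j), q^(a+2-n+3j), whose value is a single Gaussian
   coefficient. That sum is evaluated by a first-order WZ recurrence in n. The
   parameter q = 0 is treated apart, as negative powers of q occur. *)
Require Import Defs.
From mathcomp Require Import all_boot all_order all_algebra.
From mathcomp Require Import boolp classical_sets functions cardinality fsbigop.
From mathcomp Require Import zify ring.
Set Implicit Arguments.
Unset Strict Implicit.
Unset Printing Implicit Defensive.
Import Order.TTheory GRing.Theory Num.Theory.
Local Open Scope ring_scope.

(* [1 / (x;x)_m] extended by 0 to negative m, so that [invqp_pred] holds for
   every integer m and the sums need no boundary terms. *)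
Definition invqp (F : fieldType) (x : F) (m : int) : F :=
  if 0 <= m then (qpoch x x `|m|%N)^-1 else 0.

(** * Reciprocal q-factorials and Gauss's alternating sum *)

Section InvPochhammer.
Variables (F : fieldType) (x : F).
Hypothesis hx : forall k : nat, (0 < k)%N -> x ^+ k != 1.

Lemma qpochS m : qpoch x x m.+1 = qpoch x x m * (1 - x ^+ m.+1).
Proof. by rewrite /qpoch big_ord_recr /= exprS. Qed.

Lemma subr_pow_neq0 k : (0 < k)%N -> 1 - x ^+ k != 0.
Proof. by move=> k0; rewrite subr_eq0 eq_sym hx. Qed.

Lemma qpoch_neq0 m : qpoch x x m != 0.
Proof.
by apply/prodf_neq0 => k _; rewrite -exprS subr_pow_neq0.
Qed.

Lemma invqp_nat (m : nat) : invqp x m = (qpoch x x m)^-1.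
Proof. by []. Qed.

Lemma invqp0 : invqp x 0 = 1.
Proof. by rewrite /invqp /qpoch big_ord0 invr1. Qed.

Lemma invqp_neg m : m < 0 -> invqp x m = 0.
Proof. by rewrite /invqp ltNge => /negbTE ->. Qed.

Lemma invqp_pred m : invqp x (m - 1) = (1 - x ^ m) * invqp x m.
Proof.
case: m => [[|m]|m].
- by rewrite expr0z subrr mul0r.
- have -> : m.+1%:Z - 1 = m%:Z by lia.
  rewrite !invqp_nat qpochS -exprnP invfM.
  by rewrite mulrCA mulfV ?mulr1 // subr_pow_neq0.
- by rewrite !invqp_neg ?mulr0 //; lia.
Qed.

Lemma invqp_natS (m : nat) : invqp x m = (1 - x ^+ m.+1) * invqp x m.+1.
Proof. by rewrite -(invqp_pred m.+1); congr invqp; lia. Qed.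

(** Times [(x;x)_M], this is the alternating sum of the Gaussian coefficients [[M choose k]] with
    weight [x^(a k)]. *)
Definition alt_conv (a M : nat) : F :=
  \sum_(k < M.+1) (-1) ^+ k * x ^+ (a * k) * (invqp x k * invqp x (M - k)%N).

Lemma alt_conv_diffl (w : nat -> F) M :
  \sum_(k < M.+2) w k * (1 - x ^+ k) * (invqp x k * invqp x (M.+1 - k)%N)
  = \sum_(k < M.+1) w k.+1 * (invqp x k * invqp x (M - k)%N).
Proof.
rewrite big_ord_recl /= expr0 subrr mulr0 mul0r add0r.
apply: eq_bigr => k _; rewrite /bump add1n subSS [in RHS]invqp_natS.
by rewrite !mulrA.
Qed.

Lemma alt_conv_diffr (w : nat -> F) M :
  \sum_(k < M.+2) w k * (1 - x ^+ (M.+1 - k)) * (invqp x k * invqp x (M.+1 - k)%N)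
  = \sum_(k < M.+1) w k * (invqp x k * invqp x (M - k)%N).
Proof.
rewrite big_ord_recr /= subnn expr0 subrr mulr0 mul0r addr0.
apply: eq_bigr => k _; rewrite subSn; last by rewrite -ltnS.
rewrite [in RHS](invqp_natS (M - k)) [X in _ = _ * X]mulrCA.
by rewrite -!mulrA.
Qed.

(** Write [x^k = 1 - (1 - x^k)] and apply [alt_conv_diffl]; the index shift turns the sign of the
    second part into a plus. *)
Lemma alt_conv1S M : alt_conv 1 M.+1 = alt_conv 0 M.+1 + alt_conv 0 M.
Proof.
have := alt_conv_diffl (fun k => (-1) ^+ k) M.
have -> : \sum_(k < M.+1) (-1) ^+ k.+1 * (invqp x k * invqp x (M - k)%N)
  = - alt_conv 0 M.
  rewrite -sumrN; apply: eq_bigr => k _.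
  by rewrite exprS mul0n expr0 mulr1 mulN1r mulNr.
have -> : \sum_(k < M.+2) (-1) ^+ k * (1 - x ^+ k)
      * (invqp x k * invqp x (M.+1 - k)%N) = alt_conv 0 M.+1 - alt_conv 1 M.+1.
  rewrite -sumrB; apply: eq_bigr => k _.
  by rewrite mul0n mul1n expr0 mulr1 mulrBr mulr1 mulrBl.
by move=> e; rewrite -[LHS](subKr (alt_conv 0 M.+1)) e opprK.
Qed.

(* Splitting [1 - x^M = (1 - x^k) + x^k (1 - x^(M - k))]. *)
Lemma alt_conv0SS M : (1 - x ^+ M.+2) * alt_conv 0 M.+2 = alt_conv 0 M.
Proof.
have e1 := alt_conv_diffl (fun k => (-1) ^+ k) M.+1.
have e2 := alt_conv_diffr (fun k => (-1) ^+ k * x ^+ k) M.+1.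
have -> : (1 - x ^+ M.+2) * alt_conv 0 M.+2 = - alt_conv 0 M.+1 + alt_conv 1 M.+1.
  have -> : - alt_conv 0 M.+1 =
    \sum_(k < M.+2) (-1) ^+ k.+1 * (invqp x k * invqp x (M.+1 - k)%N).
    rewrite -sumrN; apply: eq_bigr => k _.
    by rewrite exprS mul0n expr0 mulr1 mulN1r mulNr.
  rewrite -e1.
  have -> : alt_conv 1 M.+1 = \sum_(k < M.+2) (-1) ^+ k * x ^+ k * (invqp x k * invqp x (M.+1 - k)%N).
    by apply: eq_bigr => k _; rewrite mul1n.
  rewrite -e2 -big_split mulr_sumr; apply: eq_bigr => k _ /=.
  have -> : x ^+ M.+2 = x ^+ k * x ^+ (M.+2 - k).
    by rewrite -exprD subnKC // -ltnS.
  by rewrite mul0n expr0; ring.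
by rewrite alt_conv1S addrA addNr add0r.
Qed.

(** The two-step recurrence [alt_conv0SS] contributes exactly the factors [1 - x^(2i)]. *)
Lemma alt_conv0_even r : alt_conv 0 (2 * r) = (qpoch (x ^+ 2) (x ^+ 2) r)^-1.
Proof.
elim: r => [|r IH].
  by rewrite /alt_conv /qpoch muln0 big_ord1 big_ord0 subnn invqp0 !mulr1 invr1.
have -> : (2 * r.+1 = (2 * r).+2)%N by lia.
have h : 1 - x ^+ (2 * r).+2 != 0 by apply: subr_pow_neq0.
apply: (mulfI h); rewrite alt_conv0SS IH /qpoch big_ord_recr /= invfM.
have -> : x ^+ 2 * x ^+ 2 ^+ r = x ^+ (2 * r).+2.
  by rewrite -exprM -exprD; congr (x ^+ _); lia.
by rewrite mulrCA mulfV ?mulr1.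
Qed.

Lemma alt_conv0_odd r : alt_conv 0 (2 * r).+1 = 0.
Proof.
elim: r => [|r IH].
  rewrite /alt_conv muln0 big_ord_recr big_ord1 /= !mul0n !expr0 expr1.
  by rewrite subn0 subnn; ring.
have -> : ((2 * r.+1).+1 = (2 * r).+3)%N by lia.
have h : 1 - x ^+ (2 * r).+3 != 0 by apply: subr_pow_neq0.
by apply: (mulfI h); rewrite alt_conv0SS IH mulr0.
Qed.

Lemma alt_convE a r : (a <= 1)%N ->
  alt_conv a (2 * r + a) = (qpoch (x ^+ 2) (x ^+ 2) r)^-1.
Proof.
case: a => [|[|//]] _; first by rewrite addn0 alt_conv0_even.
by rewrite addn1 alt_conv1S alt_conv0_odd add0r alt_conv0_even.
Qed.

End InvPochhammer.

(** * The terminating Saalschuetz sum in base [q^3] *)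

Section CubicSum.
Variables (F : fieldType) (q : F).
Hypothesis hq : forall k : nat, (0 < k)%N -> q ^+ k != 1.
Hypothesis q0 : q != 0.
Variable a : nat.

Local Notation p := (q ^+ 3).

Lemma cube_not_root k : (0 < k)%N -> p ^+ k != 1.
Proof. by move=> k0; rewrite -exprM hq // muln_gt0. Qed.

Lemma invqp_cube_pred m : invqp p (m - 1) = (1 - (q ^ m) ^+ 3) * invqp p m.
Proof.
rewrite (invqp_pred cube_not_root).
by rewrite !exprnP !exprz_exp [_ * m]mulrC.
Qed.

(** The summand in [r] for fixed [j] after the exchange. The exponent [a * r] is the part of the
    weight [p^(a (r - j))] that depends on [r]. The factor [invqp q] encodes the condition
    [3r <= n - a]. *)
Definition cubic_term (j : int) (n r : nat) : F :=
  qpoch p p (n - r - 1) * p ^+ (r ^ 2 + a * r)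
  * (invqp q (n%:Z - 3 * r%:Z - a%:Z)
     * (invqp p (r%:Z - j) * invqp p (r%:Z + j + a%:Z))).

(* The WZ companion: a rational multiple of [cubic_term j n r], with the
   denominators absorbed in the shifted arguments. *)
Definition cubic_cert (j : int) (n r : nat) : F :=
  - (q ^ (n%:Z + 1 - 3 * r%:Z - a%:Z) * qpoch p p (n - r)
     * p ^+ (r ^ 2 + a * r)
     * (invqp q (n%:Z + 1 - 3 * r%:Z - a%:Z)
        * (invqp p (r%:Z - j - 1) * invqp p (r%:Z + j + a%:Z - 1)))).

Lemma cubic_wz (j : int) (n r : nat) : (r < n)%N ->
  (1 - q ^ (n%:Z + 1 - 3 * j - a%:Z)) * (1 - q ^ (n%:Z + 1 + 3 * j + 2 * a%:Z))
    * cubic_term j n.+1 r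
  - (1 - q ^+ (2 * n + a)) * (1 - q ^+ (2 * n + a).+1) * cubic_term j n r
  = cubic_cert j n r.+1 - cubic_cert j n r.
Proof.
move=> rn; rewrite /cubic_term /cubic_cert.
have hp := cube_not_root.
(* Since [r < n], the truncated subtractions are exact, and all Pochhammer symbols reduce to common
   ones. *)
have -> : (n.+1 - r - 1 = (n - r.+1).+1)%N by lia.
have -> : (n - r - 1 = n - r.+1)%N by lia.
have -> : (n - r = (n - r.+1).+1)%N by lia.
rewrite !qpochS; set U := qpoch p p _.
have -> : (r.+1 ^ 2 + a * r.+1 = r ^ 2 + a * r + (2 * r + a + 1))%N by lia.
rewrite [p ^+ (_ + (_ + 1))]exprD; set E := p ^+ (r ^ 2 + a * r).
have -> : r.+1%:Z - j = r%:Z - j + 1 by lia.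
have -> : r.+1%:Z + j + a%:Z - 1 = r%:Z + j + a%:Z by lia.
rewrite addrK.
rewrite !invqp_cube_pred.
set m := n%:Z + 1 - 3 * r%:Z - a%:Z.
have -> : n.+1%:Z - 3 * r%:Z - a%:Z = m by rewrite /m; lia.
have -> : n%:Z - 3 * r%:Z - a%:Z = m - 1 by rewrite /m; lia.
have -> : n%:Z + 1 - 3 * r.+1%:Z - a%:Z = m - 1 - 1 - 1 by rewrite /m; lia.
rewrite !invqp_pred //.
set e := invqp q m; set f := invqp p _; set g := invqp p _.
(* In these variables every power is a Laurent monomial, so what remains is an identity of rational
   functions. *)
pose N := q ^ n%:Z; pose A := q ^ a%:Z; pose R := q ^ r%:Z; pose J := q ^ j.
have cube k : q ^ (3 * k) = (q ^ k) ^+ 3 by rewrite mulrC exprnP exprz_exp.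
have sq k : q ^ (2 * k) = (q ^ k) ^+ 2 by rewrite mulrC exprnP exprz_exp.
have D := fun x y => expfzDr x y q0.
have V x : q ^ (- x) = (q ^ x)^-1 by rewrite invr_expz.
have [N0 A0 R0 J0] : [/\ N != 0, A != 0, R != 0 & J != 0] by split; apply: expfz_neq0.
have -> : q ^ (n%:Z + 1 - 3 * j - a%:Z) = q * N / (J ^+ 3 * A).
  by rewrite !D !V cube expr1z /N /J /A; field; rewrite ?J0 ?A0.
have -> : q ^ (n%:Z + 1 + 3 * j + 2 * a%:Z) = q * N * J ^+ 3 * A ^+ 2.
  by rewrite !D cube sq expr1z /N /J /A; ring.
have Em: q ^ m = q * N / (R ^+ 3 * A).
  by rewrite /m !D !V cube expr1z /N /R /A; field; rewrite ?R0 ?A0.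
clearbody m.
have -> : q ^ (m - 1 - 1 - 1) = N / (q ^+ 2 * R ^+ 3 * A).
  by rewrite !D !V Em expr1z; field; rewrite ?q0 ?R0 ?A0.
have -> : q ^ (m - 1 - 1) = N / (q * R ^+ 3 * A).
  by rewrite !D !V Em expr1z; field; rewrite ?q0 ?R0 ?A0.
have -> : q ^ (m - 1) = N / (R ^+ 3 * A).
  by rewrite !D !V Em expr1z; field; rewrite ?q0 ?R0 ?A0.
have -> : q ^ (r%:Z - j) = R / J by rewrite D V.
have -> : q ^ (r%:Z + j + a%:Z) = R * J * A by rewrite !D.
rewrite Em.
have -> : q ^+ (2 * n + a) = N ^+ 2 * A.
  by rewrite exprD mulnC exprM.
have -> : q ^+ (2 * n + a).+1 = q * N ^+ 2 * A.
  by rewrite exprS exprD mulnC exprM mulrA.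
have -> : p ^+ (n - r.+1).+1 = N ^+ 3 / R ^+ 3.
  have -> : N = R * q ^+ (n - r.+1).+1 by rewrite /N /R -exprnP -exprD -subSn // subSS subnKC // ltnW.
  by rewrite -exprM mulnC exprM; field; rewrite R0.
have -> : p ^+ (2 * r + a + 1) = q ^+ 3 * R ^+ 6 * A ^+ 3.
  by rewrite /R /A -!exprnP -!exprM -!exprD; congr (q ^+ _); lia.
clearbody N A R J U E e f g.
field.
by rewrite ?q0 ?N0 ?A0 ?R0 ?J0.
Qed.

Definition cubic_sum (j : int) (n : nat) : F :=
  \sum_(0 <= r < n) cubic_term j n r.

(** The Gaussian coefficient [[2n+a choose n-3j-a]] times [p^(j^2 + a j)], with the factor
    [1 - q^(2n+a)] removed from its numerator. *)
Definition cubic_value (j : int) (n : nat) : F :=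
  p ^ (j ^+ 2 + a%:Z * j) * qpoch q q (2 * n + a - 1)
  * (invqp q (n%:Z - 3 * j - a%:Z) * invqp q (n%:Z + 3 * j + 2 * a%:Z)).

Lemma cubic_sum_rec (j : int) (n : nat) : (a <= 1)%N -> (0 < n)%N ->
  (1 - q ^ (n%:Z + 1 - 3 * j - a%:Z)) * (1 - q ^ (n%:Z + 1 + 3 * j + 2 * a%:Z))
    * cubic_sum j n.+1
  = (1 - q ^+ (2 * n + a)) * (1 - q ^+ (2 * n + a).+1) * cubic_sum j n.
Proof.
move=> a1 n0; apply/eqP; rewrite -subr_eq0; apply/eqP.
(* The extra term [r = n] vanishes because [n + 1 - 3n - a < 0]; the other terms telescope by
   [cubic_wz]. *)
rewrite /cubic_sum big_nat_recr //= [cubic_term j n.+1 n]/cubic_term.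
rewrite (invqp_neg q (m := n.+1%:Z - _ - _)); last by lia.
rewrite mul0r mulr0 addr0 !mulr_sumr -sumrB.
rewrite (telescope_sumr_eq (cubic_cert j n)) //; last first.
  by move=> r /andP[_ rn]; rewrite cubic_wz.
rewrite /cubic_cert (invqp_neg q (m := n%:Z + 1 - 3 * n%:Z - _)); last by lia.
rewrite mul0r mulr0 oppr0 sub0r opprK.
(* The lower boundary [r = 0] vanishes too: one of the indices [-j - 1] and [j + a - 1] is negative,
   the second for [j < 0] because [a <= 1]. *)
have [j0|j0] := leP 0 j.
  by rewrite (invqp_neg _ (m := 0%:Z - j - 1)) ?mul0r ?mulr0 //; lia.
by rewrite (invqp_neg _ (m := 0%:Z + j + a%:Z - 1)) ?mulr0 //; lia.
Qed.

Lemma cubic_value_rec (j : int) (n : nat) : (0 < n)%N ->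
  (1 - q ^ (n%:Z + 1 - 3 * j - a%:Z)) * (1 - q ^ (n%:Z + 1 + 3 * j + 2 * a%:Z))
    * cubic_value j n.+1
  = (1 - q ^+ (2 * n + a)) * (1 - q ^+ (2 * n + a).+1) * cubic_value j n.
Proof.
move=> n0; rewrite /cubic_value.
have -> : (2 * n.+1 + a - 1 = (2 * n + a - 1).+2)%N by lia.
rewrite !qpochS.
have -> : ((2 * n + a - 1).+1 = 2 * n + a)%N by lia.
have -> : n%:Z - 3 * j - a%:Z = (n%:Z + 1 - 3 * j - a%:Z) - 1 by lia.
have -> : n%:Z + 3 * j + 2 * a%:Z = (n%:Z + 1 + 3 * j + 2 * a%:Z) - 1 by lia.
rewrite !(invqp_pred hq).
have -> : n.+1%:Z - 3 * j - a%:Z = n%:Z + 1 - 3 * j - a%:Z by lia.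
have -> : n.+1%:Z + 3 * j + 2 * a%:Z = n%:Z + 1 + 3 * j + 2 * a%:Z by lia.
ring.
Qed.

(* The smallest n with a nonzero sum, where [cubic_sum_rec] degenerates to 0 = 0. *)
Lemma cubic_sum_first (i n : nat) : (0 < i)%N -> n = (3 * i + a)%N ->
  cubic_sum i n = cubic_value i n.
Proof.
move=> i0 ->; rewrite /cubic_sum.
have lt : (i < 3 * i + a)%N by lia.
(* Only [r = i] survives: [1/(p;p)_(r-i)] vanishes for [r < i], and [1/(q;q)_(3i-3r)] for
   [r > i]. *)
rewrite big_mkord (bigD1 (Ordinal lt)) //= big1 ?addr0 => [|r ri]; last first.
  rewrite /cubic_term; have {ri} : (r : nat) != i by apply: contra_neq ri => e; apply: val_inj.
  rewrite neq_ltn => /orP[h|h].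
    by rewrite (invqp_neg _ (m := _ - i%:Z)) ?mul0r ?mulr0 //; lia.
  by rewrite (invqp_neg q) ?mul0r ?mulr0 //; lia.
rewrite /cubic_term /cubic_value.
have -> : (3 * i + a)%N%:Z - 3 * i%:Z - a%:Z = 0 by lia.
rewrite subrr !invqp0 !mul1r.
have -> : (3 * i + a - i - 1 = 2 * i + a - 1)%N by lia.
have -> : (2 * (3 * i + a) + a - 1 = 6 * i + 3 * a - 1)%N by lia.
have -> : i%:Z + i%:Z + a%:Z = (2 * i + a - 1).+1 by lia.
have -> : (3 * i + a)%N%:Z + 3 * i%:Z + 2 * a%:Z = (6 * i + 3 * a - 1).+1 by lia.
rewrite !invqp_nat !qpochS.
have -> : i%:Z ^+ 2 + a%:Z * i%:Z = (i ^ 2 + a * i)%N by lia.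
rewrite -exprnP -(exprM q 3 (2 * i + a - 1).+1).
have -> : (3 * (2 * i + a - 1).+1 = (6 * i + 3 * a - 1).+1)%N by lia.
have h1 := qpoch_neq0 hq (6 * i + 3 * a - 1).
have h2 := qpoch_neq0 cube_not_root (2 * i + a - 1).
have h3 := subr_pow_neq0 hq (ltn0Sn (6 * i + 3 * a - 1)).
by field; rewrite ?h1 ?h2 ?h3.
Qed.

(** Induction on [n] from [n = 1]: both sides satisfy the same recurrence, whose leading coefficient
    vanishes only on reaching [3i + a], the case of [cubic_sum_first]. *)
Lemma cubic_sum_nat (i n : nat) : (a <= 1)%N -> (0 < n)%N ->
  cubic_sum i n = cubic_value i n.
Proof.
move=> a1; elim: n => // n IH _.
have [n0|] := posnP n.
  rewrite n0 /cubic_sum big_nat1 /cubic_term /cubic_value.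
  have [i0|i0] := posnP i; last first.
    rewrite (invqp_neg _ (m := 0%:Z - i%:Z)); last by lia.
    by rewrite (invqp_neg q (m := 1%:Z - 3 * i%:Z - a%:Z)) ?mul0r ?mulr0 //; lia.
  rewrite i0; case: a a1 => [|[|//]] _.
    have h := subr_pow_neq0 hq (isT : (0 < 1)%N).
    rewrite expr1 in h.
    rewrite !invqp_nat /qpoch /= !big_ord_recl !big_ord0 /=.
    rewrite !expr0 !mulr1 !invr1.
    by field.
  have h2 := subr_pow_neq0 hq (isT : (0 < 2)%N).
  have h3 := subr_pow_neq0 hq (isT : (0 < 3)%N).
  have h1 := subr_pow_neq0 hq (isT : (0 < 1)%N).
  rewrite expr1 in h1.
  rewrite !invqp_nat /qpoch /= !big_ord_recl !big_ord0 /=.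
  rewrite ?expr0 ?mulr1 ?invr1 /bump /= -!exprS.
  have -> : 0%Z ^+ 2 + 1%Z * 0%Z = 0 :> int by [].
  by rewrite expr0z; field; rewrite ?h1 ?h2 ?h3.
move=> n0; have [e|ne] := eqVneq n.+1 (3 * i + a)%N.
  by apply: cubic_sum_first => //; lia.
have c k : k != 0 -> 1 - q ^ k != 0.
  move=> k0; rewrite subr_eq0 eq_sym; case: k k0 => [[//|k]|k] _; first exact: hq.
  by rewrite NegzE -invr_expz invr_eq1 hq.
have h1 : 1 - q ^ (n%:Z + 1 - 3 * i%:Z - a%:Z) != 0 by apply: c; lia.
have h2 : 1 - q ^ (n%:Z + 1 + 3 * i%:Z + 2 * a%:Z) != 0 by apply: c; lia.
apply: (mulfI (mulf_neq0 h1 h2)).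
by rewrite cubic_sum_rec // cubic_value_rec // IH.
Qed.

(** The reflection swaps the two factors in base [p]. As [a <= 1], it sends negative [j] to
    nonnegative ones, which reduces [cubic_sumE] to natural [j]. *)
Lemma cubic_sum_sym (j : int) (n : nat) :
  cubic_sum (- j - a%:Z) n = cubic_sum j n.
Proof.
apply: eq_bigr => r _; rewrite /cubic_term; congr (_ * (_ * _)).
by rewrite mulrC; congr (invqp _ _ * invqp _ _); lia.
Qed.

Lemma cubic_value_sym (j : int) (n : nat) :
  cubic_value (- j - a%:Z) n = cubic_value j n.
Proof.
rewrite /cubic_value; congr (_ ^ _ * _ * _); first by ring.
by rewrite mulrC; congr (invqp _ _ * invqp _ _); lia.
Qed.

Lemma cubic_sumE (j : int) (n : nat) : (a <= 1)%N -> (0 < n)%N ->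
  cubic_sum j n = cubic_value j n.
Proof.
move=> a1 n0; have [j0|j0] := leP 0 j.
  by rewrite -(gez0_abs j0) cubic_sum_nat.
rewrite -cubic_sum_sym -cubic_value_sym.
have j1 : 0 <= - j - a%:Z by lia.
by rewrite -(gez0_abs j1) cubic_sum_nat.
Qed.

(** The prefactor completes [(q;q)_(2n+a-1)] to the numerator of the Gaussian coefficient; the zero
    conventions of [invqp] and [qbinom] agree. *)
Lemma cubic_transformation (j : int) (n : nat) : (a <= 1)%N -> (0 < n)%N ->
  (1 - q ^+ (2 * n + a)) * cubic_sum j n
  = p ^ (j ^+ 2 + a%:Z * j)
    * qbinom q (2 * n%:Z + a%:Z) (n%:Z - 3 * j - a%:Z).
Proof.
move=> a1 n0; rewrite cubic_sumE // /cubic_value /qbinom.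
have -> : 2 * n%:Z + a%:Z - (n%:Z - 3 * j - a%:Z) = n%:Z + 3 * j + 2 * a%:Z by ring.
have -> : absz (2 * n%:Z + a%:Z) = (2 * n + a - 1).+1 by lia.
rewrite qpochS /invqp; have -> : ((2 * n + a - 1).+1 = 2 * n + a)%N by lia.
case: (0 <= n%:Z - _ - _); case: (0 <= n%:Z + _ + _); rewrite /= ?mul0r ?mulr0 //.
rewrite invfM; ring.
Qed.

End CubicSum.

(** * Sums over all integers and the exchange of summations *)

Lemma fsum_seq (F : fieldType) (s : seq int) (f : int -> F) : uniq s ->
  (forall j, j \notin s -> f j = 0) ->
  \sum_(j \in [set: int]) f j = \sum_(j <- s) f j.
Proof.
move=> us fs; rewrite (@fsbigE _ _ _ _ _ s) //; last by move=> j _; apply: fs.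
by apply: eq_bigl => j; rewrite in_setT.
Qed.

(** Substitute [k = r - j]. Letting [j] run over all integers makes the range independent of [r], as
    the exchange requires. *)
Lemma alt_fsum (F : fieldType) (x : F) (a r : nat) :
  \sum_(j \in [set: int]) (-1) ^ j * x ^ (a%:Z * (r%:Z - j))
    * (invqp x (r%:Z - j) * invqp x (r%:Z + j + a%:Z))
  = (-1) ^+ r * alt_conv x a (2 * r + a).
Proof.
pose s : seq int := [seq r%:Z - k%:Z | k <- iota 0 (2 * r + a).+1].
rewrite (@fsum_seq _ s).
- rewrite big_map -/(index_iota 0 (2 * r + a).+1) big_mkord mulr_sumr.
  apply: eq_bigr => k _.
  have -> : r%:Z - (r%:Z - k%:Z) = k by lia.
  have -> : r%:Z + (r%:Z - k%:Z) + a%:Z = (2 * r + a - k)%N by have := ltn_ord k; lia.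
  rewrite expfzDr ?oppr_eq0 ?oner_eq0 // -invr_expz -!exprnP invr_sign.
  by rewrite !mulrA.
- by rewrite map_inj_uniq ?iota_uniq // => k l; lia.
- move=> j js.
  have [h|h] := ltP (r%:Z - j) 0; first by rewrite (invqp_neg _ h) mul0r mulr0.
  have [h2|h2] := ltP (r%:Z + j + a%:Z) 0; first by rewrite (invqp_neg _ h2) !mulr0.
  case/negP: js; have -> : j = r%:Z - (absz (r%:Z - j))%:Z by lia.
  by apply: (map_f (fun k : nat => r%:Z - k%:Z)); rewrite mem_iota; lia.
Qed.

Lemma theorem1p6_neq0 (F : fieldType) (q : F)
    (hq : forall k : nat, (0 < k)%N -> q ^+ k != 1) (q0 : q != 0)
    (n a : nat) (hn : (0 < n)%N) (ha : (a <= 1)%N) :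
  \sum_(0 <= j < n.+1 | (3 * j <= n - a)%N)
     ((-1) ^+ j * qpoch (q ^+ 3) (q ^+ 3) (n - j - 1)
        * (1 - q ^+ (2 * n + a)) * q ^+ (3 * j ^ 2))
     / (qpoch q q (n - 3 * j - a) * qpoch (q ^+ 6) (q ^+ 6) j)
  = \sum_(j \in [set: int])
      (-1) ^ j * q ^ (3 * j ^+ 2)
        * qbinom q (2 * n%:Z + a%:Z) (n%:Z - 3 * j - a%:Z).
Proof.
set D := 1 - _; set p := q ^+ 3.
have p0 : p != 0 by rewrite expf_neq0.
(* The interval from [-n-1] to [n+1] contains the support of the right-hand side and of every inner
   sum with [r < n]. *)
pose s : seq int := [seq k%:Z - n%:Z - 1 | k <- iota 0 (2 * n).+3].
have us : uniq s by rewrite map_inj_uniq ?iota_uniq // => k l; lia.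
have sP j : j \notin s -> n%:Z < j \/ j < - n%:Z - 1.
  move=> js; have [h|h] := ltP n%:Z j; first by left.
  have [h2|h2] := ltP j (- n%:Z - 1); first by right.
  case/negP: js; have -> : j = (absz (j + n%:Z + 1))%:Z - n%:Z - 1 by lia.
  by apply: (map_f (fun k : nat => k%:Z - n%:Z - 1)); rewrite mem_iota; lia.
rewrite [RHS](fsum_seq us); last first.
  move=> j /sP js; rewrite /qbinom ifF ?mulr0 //.
  by apply/negbTE/negP => /andP[]; lia.
transitivity (\sum_(0 <= r < n) \sum_(j <- s)
    (-1) ^ j * p ^ (- (a%:Z * j)) * (D * cubic_term q a j n r)); last first.
  rewrite exchange_big /=; apply: eq_bigr => j _.
  rewrite -mulr_sumr -mulr_sumr cubic_transformation // mulrA; congr (_ * _).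
  (* The weight [p^(-a j)] cancels the linear part of the exponent [j^2 + a j], leaving
     [q^(3 j^2)]. *)
  rewrite -mulrA -expfzDr //; congr (_ * _).
  by rewrite /p (exprnP q 3) exprz_exp; congr (q ^ _); ring.
(* The last index [n] fails [3n <= n - a], so the range matches that of [cubic_sum]. *)
rewrite big_mkcond big_nat_recr //= ifF; last by apply/negbTE; lia.
rewrite addr0 big_nat [RHS]big_nat; apply: eq_bigr => r /andP[_ rn].
rewrite /cubic_term; case: ifPn => h; last first.
  rewrite (invqp_neg q); last by lia.
  by rewrite big1 // => j _; rewrite mul0r !mulr0.
have -> : q ^+ 6 = p ^+ 2 by rewrite -exprM.
rewrite invfM -(alt_convE (cube_not_root hq) r ha).
have -> : n%:Z - 3 * r%:Z - a%:Z = (n - 3 * r - a)%N by lia.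
rewrite invqp_nat exprM -/p.
set U := qpoch p p _; set V := (qpoch q q _)^-1.
transitivity (D * U * V * p ^+ (r ^ 2) * ((-1) ^+ r * alt_conv p a (2 * r + a))).
  ring.
rewrite -alt_fsum (fsum_seq us); last first.
  move=> j /sP[jr|jr].
    by rewrite (invqp_neg _ (m := r%:Z - j)) ?mul0r ?mulr0 //; lia.
  by rewrite (invqp_neg _ (m := _ + j + _)) ?mulr0 //; lia.
rewrite mulr_sumr; apply: eq_bigr => j _.
have -> : a%:Z * (r%:Z - j) = (a * r)%N%:Z + (- (a%:Z * j)) by rewrite PoszM; ring.
rewrite expfzDr // -exprnP exprD; ring.
Qed.

Theorem theorem1p6 (F : fieldType) (q : F)
    (hq : forall k : nat, (0 < k)%N -> q ^+ k != 1)
    (n a : nat) (hn : (0 < n)%N) (ha : a \in [:: 0%N; 1%N]) :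
  \sum_(0 <= j < n.+1 | (3 * j <= n - a)%N)
     ((-1) ^+ j * qpoch (q ^+ 3) (q ^+ 3) (n - j - 1)
        * (1 - q ^+ (2 * n + a)) * q ^+ (3 * j ^ 2))
     / (qpoch q q (n - 3 * j - a) * qpoch (q ^+ 6) (q ^+ 6) j)
  = \sum_(j \in [set: int])
      (-1) ^ j * q ^ (3 * j ^+ 2)
        * qbinom q (2 * n%:Z + a%:Z) (n%:Z - 3 * j - a%:Z).
Proof.
have a1 : (a <= 1)%N by move: ha; rewrite !inE => /orP[] /eqP ->.
have [q0|q0] := eqVneq q 0; last exact: theorem1p6_neq0.
(* At [q = 0] only [j = 0] contributes to either sum, and both terms equal 1. *)
have Q m : qpoch (0 : F) 0 m = 1.
  by rewrite /qpoch big1 // => k _; rewrite mul0r subr0.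
rewrite q0 !expr0n /= (@fsum_seq _ [:: 0]) //; last first.
  move=> j; rewrite inE => j0; rewrite exp0rz.
  by have /negbTE -> : 3 * j ^+ 2 != 0; [rewrite mulf_neq0 ?expf_neq0 | rewrite mulr0 mul0r].
rewrite big_seq1 /qbinom ifT; last by apply/andP; split; lia.
rewrite big_mkcond big_nat_recl //= big1 ?addr0 => [|j _]; last first.
  by case: ifP => // _; rewrite expr0n /= mulr0 mul0r.
rewrite !Q expr0n /= !expr0z !mulr1 !invr1 addn_eq0 muln_eq0 /=.
by rewrite -(prednK hn) /= subr0 !mulr1 ?invr1.
Qed.
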